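(* Consider the closed-loop system $\dot x = Ax+BKq(x)$, where $A\in\mathbb{R}^{n\times n}$, $B\in\mathbb{R}^{n\times m}$, $K\in\mathbb{R}^{m\times n}$, all eigenvalues of $A+BK$ have negative real parts, and $BK\ne0$. Let $P$ be the unique positive definite symmetric matrix with $(A+BK)^TP+P(A+BK)=-I$. Let $M>m>0$ and consider the ellipsoids $$\mathcal{R}_1 := \{x\in\mathbb{R}^n : x^TPx\le\lambda_{\min}(P)M^2\},\qquad \mathcal{R}_2 := \{x\in\mathbb{R}^n : x^TPx\le\lambda_{\max}(P)m^2\}.$$ Let $q$ be a quantizer whose domain contains $\mathcal{R}_1$, and define $$\Delta_{rw} := \max_{x\in\mathcal{R}_1\setminus\mathcal{R}_2}\frac{|q(x)-x|}{|x|}.$$ Assume that $$\lambda_{\min}(P)M^2>\lambda_{\max}(P)m^2 \qquad\text{and}\qquad \Delta_{rw}\le\frac{1-\varepsilon}{2\|PBK\|}$$ for some $\varepsilon>0$. Then $\mathcal{R}_1$ and $\mathcal{R}_2$ are invariant regions for the closed-loop system. Moreover, all solutions that start in $\mathcal{R}_1$ enter the smaller ellipsoid $\mathcal{R}_2$ in finite time, and an upper bound on this time is $$T=\frac{\lambda_{\min}(P)M^2-\lambda_{\max}(P)m^2}{m^2\varepsilon}.$$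
   Context: $|\cdot|$ is the Euclidean norm and $\|\cdot\|$ the induced matrix norm; $\lambda_{\min}(P)$, $\lambda_{\max}(P)$ are the smallest and largest eigenvalues of $P$. A quantizer is a function $q:\mathcal{D}\subset\mathbb{R}^n\to\mathcal{Q}$, where $\mathcal{Q}=\{q_1,\dots,q_N\}\subset\mathbb{R}^n$ is a finite set; it is piecewise constant, and the sets $\{x : q(x)=q_i\}$ partition $\mathcal{D}$. The maximum defining $\Delta_{rw}$ is understood as a supremum if it is not attained. Solutions are absolutely continuous functions $x:[t_0,\infty)\to\mathbb{R}^n$ satisfying the differential equation for almost every $t$. A region is invariant if every solution starting in it remains in it for all later times. ''Upper bound $T$ on the time'' means that a solution with $x(t_0)\in\mathcal{R}_1$ satisfies $x(t)\in\mathcal{R}_2$ for some $t\in[t_0,t_0+T]$ (hence for all $t\ge t_0+T$).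
   Formalization: For solutions starting on the boundary of R1, invariance of R1 and the time bound assume also that |q(x)-x|/|x| ≤ 1/(2‖PBK‖) at domain points just outside R1; without this a solution may leave R1 at once. Interior starts and R2 need no extra condition. *)

(* Defs.v *)
From HB Require Import structures.
From mathcomp Require Import all_boot all_order all_algebra.
From mathcomp Require Import complex.
From mathcomp Require Import all_classical all_reals all_analysis.
Import Order.TTheory GRing.Theory Num.Theory.
Import numFieldNormedType.Exports.

Set Implicit Arguments.
Unset Strict Implicit.
Unset Printing Implicit Defensive.

Local Open Scope classical_set_scope.
Local Open Scope ring_scope.

(* The library norm on matrices is the max norm, hence the following two. *)
Definition enorm (R : realType) (n : nat) (x : 'cV[R]_n) : R :=
  Num.sqrt (\sum_(i < n) x i 0 ^+ 2).

Definition opnorm (R : realType) (m n : nat) (A : 'M[R]_(m, n)) : R :=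
  sup [set enorm (A *m x) | x in [set x : 'cV[R]_n | enorm x <= 1]].

Definition qform (R : realType) (n : nat) (P : 'M[R]_n) (x : 'cV[R]_n) : R :=
  (x^T *m P *m x) 0 0.

Definition posdef (R : realType) (n : nat) (P : 'M[R]_n) : Prop :=
  forall x : 'cV[R]_n, x != 0 -> 0 < qform P x.

(* Used for real symmetric P with n > 0, where the set of real eigenvalues is
   finite and nonempty: inf and sup are then attained. *)
Definition lambda_min (R : realType) (n : nat) (P : 'M[R]_n) : R :=
  inf [set a : R | eigenvalue P a].

Definition lambda_max (R : realType) (n : nat) (P : 'M[R]_n) : R :=
  sup [set a : R | eigenvalue P a].

Definition hurwitz (R : realType) (n : nat) (A : 'M[R]_n) : Prop :=
  forall z : R[i],
    eigenvalue (map_mx (real_complex R) A) z -> complex.Re z < 0.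

Definition ellipsoid (R : realType) (n : nat) (P : 'M[R]_n) (c : R) :
  set 'cV[R]_n := [set x | qform P x <= c].

(* A map q : D -> Q with Q finite, encoded as a total function whose values
   outside D are irrelevant; its level sets in D are the quantization cells. *)
Definition quantizer (R : realType) (n : nat) (D : set 'cV[R]_n)
  (q : 'cV[R]_n -> 'cV[R]_n) : Prop := finite_set (q @` D).

Definition rel_error (R : realType) (n : nat) (q : 'cV[R]_n -> 'cV[R]_n)
  (x : 'cV[R]_n) : R := enorm (q x - x) / enorm x.

(* The real sup is meaningful as soon as the set of relative errors on S is
   nonempty and bounded; this holds when q has finite range on S and S is
   nonempty and avoids a neighborhood of 0. *)
Definition Delta (R : realType) (n : nat) (q : 'cV[R]_n -> 'cV[R]_n)
  (S : set 'cV[R]_n) : R := sup [set rel_error q x | x in S].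

Definition abs_continuous (R : realType) (n : nat) (a b : R)
  (x : R -> 'cV[R]_n) : Prop :=
  forall e : R, 0 < e -> exists2 d : R, 0 < d &
    forall (N : nat) (u v : 'I_N -> R),
      (forall i, a <= u i /\ u i <= v i /\ v i <= b) ->
      trivIset setT (fun i => [set` `]u i, v i[]) ->
      \sum_(i < N) (v i - u i) < d ->
      \sum_(i < N) enorm (x (v i) - x (u i)) < e.

(* Caratheodory solutions on [t0, +oo[ of x' = A x + B K q(x), absolutely
   continuous on every compact subinterval; the equation makes sense at time t
   only when x t lies in the domain D of q. Values of x before t0 are
   irrelevant. *)
Definition closed_loop_solution (R : realType) (n m : nat)
  (A : 'M[R]_n) (B : 'M[R]_(n, m)) (K : 'M[R]_(m, n))
  (D : set 'cV[R]_n) (q : 'cV[R]_n -> 'cV[R]_n)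
  (t0 : R) (x : R -> 'cV[R]_n) : Prop :=
  (forall t1, abs_continuous t0 t1 x) /\
  {ae lebesgue_measure, forall t : R, t0 < t ->
     D (x t) /\ is_derive t 1 x (A *m x t + B *m K *m q (x t))}.

Definition invariant_region (R : realType) (n m : nat)
  (A : 'M[R]_n) (B : 'M[R]_(n, m)) (K : 'M[R]_(m, n))
  (D : set 'cV[R]_n) (q : 'cV[R]_n -> 'cV[R]_n) (S : set 'cV[R]_n) : Prop :=
  forall (t0 : R) (x : R -> 'cV[R]_n),
    closed_loop_solution A B K D q t0 x -> S (x t0) ->
    forall t, t0 <= t -> S (x t).

Definition reaches_within (R : realType) (n m : nat)
  (A : 'M[R]_n) (B : 'M[R]_(n, m)) (K : 'M[R]_(m, n))
  (D : set 'cV[R]_n) (q : 'cV[R]_n -> 'cV[R]_n) (S S' : set 'cV[R]_n)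
  (T : R) : Prop :=
  forall (t0 : R) (x : R -> 'cV[R]_n),
    closed_loop_solution A B K D q t0 x -> S (x t0) ->
    exists2 t, t0 <= t <= t0 + T & S' (x t).

(* Points of D just outside S also have relative error at most c (vacuous when
   D = S). Without such a condition a Caratheodory solution may leave a closed
   region S from its boundary although the field points inwards there: take
   n = 1, S = [-2, 2] and x' = - q(x) with q = 3/2 on [0, 2], q = - 3/2 on
   [-2, 0[ and q = - 1 elsewhere; then x(t) = 2 + t is a solution. *)
Definition error_bound_past (R : realType) (n : nat) (D : set 'cV[R]_n)
  (q : 'cV[R]_n -> 'cV[R]_n) (S : set 'cV[R]_n) (c : R) : Prop :=
  exists U : set 'cV[R]_n, [/\ open U, S `<=` U &
    forall x, (U `&` D `\` S) x -> rel_error q x <= c].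

(* Main.v *)
Require Import Defs.
From HB Require Import structures.
From mathcomp Require Import all_boot all_order all_algebra.
From mathcomp Require Import complex ring lra.
From mathcomp Require Import all_classical all_reals all_analysis.
Import Order.TTheory GRing.Theory Num.Theory.
Import numFieldNormedType.Exports.

(** Along a solution, V = x^T P x is absolutely continuous and, by the Lyapunov
    equation, V' = - |x|^2 + 2 x^T P B K (q(x) - x) for almost every t. Since
    V <= lambda_max P |x|^2, outside R2 one has |x| > m, so on R1 \ R2 the bound
    on the relative error gives V' <= - eps |x|^2 <= - eps m^2. An absolutely
    continuous function whose derivative is almost everywhere at most k grows
    at rate at most k; hence V reaches its value on the boundary of R2 within
    time T, and V cannot rise above a level c if V' <= 0 almost everywhere just
    after each time at which V <= c, at the points where V > c: consider the
    last time at which V <= c. *)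

Set Implicit Arguments.
Unset Strict Implicit.
Unset Printing Implicit Defensive.

Local Open Scope classical_set_scope.
Local Open Scope ring_scope.

(** * Euclidean norm, quadratic forms and the largest eigenvalue *)

Section EuclideanForms.
Context {R : realType}.

Definition bform (n : nat) (S : 'M[R]_n) (x y : 'cV[R]_n) : R :=
  (x^T *m S *m y) 0 0.

Lemma enormE n (x : 'cV[R]_n) : enorm x ^+ 2 = (x^T *m x) 0 0.
Proof.
rewrite /enorm sqr_sqrtr ?sumr_ge0// => [|i _]; last exact: sqr_ge0.
by rewrite mxE; apply: eq_bigr => i _; rewrite mxE expr2.
Qed.

Lemma enorm_ge0 n (x : 'cV[R]_n) : 0 <= enorm x.
Proof. exact: sqrtr_ge0. Qed.

Lemma qform1 n (x : 'cV[R]_n) : qform 1%:M x = enorm x ^+ 2.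
Proof. by rewrite enormE /qform mulmx1. Qed.

Lemma enorm_eq0 n (x : 'cV[R]_n) : enorm x = 0 -> x = 0.
Proof.
move=> /(congr1 (fun a => a ^+ 2)); rewrite /enorm sqr_sqrtr; last first.
  by rewrite sumr_ge0// => i _; exact: sqr_ge0.
rewrite expr0n /= => /eqP; rewrite psumr_eq0; last by move=> i _; exact: sqr_ge0.
move=> /allP xi0; apply/matrixP => i j; rewrite ord1 mxE.
by apply/eqP; rewrite -sqrf_eq0; apply: xi0; rewrite mem_index_enum.
Qed.

Lemma enorm_gt0 n (x : 'cV[R]_n) : x != 0 -> 0 < enorm x.
Proof.
move=> x0; rewrite lt_neqAle enorm_ge0 andbT eq_sym.
by apply: contra_neq x0; exact: enorm_eq0.
Qed.

Lemma le_coord_enorm n (x : 'cV[R]_n) i : `|x i 0| <= enorm x.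
Proof.
rewrite -(@ler_pXn2r _ 2)// ?nnegrE ?enorm_ge0//.
rewrite /enorm sqr_sqrtr ?sumr_ge0// => [|j _]; last exact: sqr_ge0.
rewrite real_normK ?num_real// (bigD1 i)//= lerDl sumr_ge0// => j _.
exact: sqr_ge0.
Qed.

Lemma bformC n (S : 'M[R]_n) x y : S^T = S -> bform S x y = bform S y x.
Proof.
move=> Ssym; rewrite /bform -[in RHS](trmxK (y^T *m S *m x)) [in RHS]mxE.
by rewrite !trmx_mul trmxK Ssym mulmxA.
Qed.

Lemma bformDr n (S : 'M[R]_n) x y z :
  bform S x (y + z) = bform S x y + bform S x z.
Proof. by rewrite /bform mulmxDr mxE. Qed.

Lemma bformZr n (S : 'M[R]_n) a x y : bform S x (a *: y) = a * bform S x y.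
Proof. by rewrite /bform -scalemxAr mxE. Qed.

Lemma bformDl n (S : 'M[R]_n) x y z :
  bform S (x + y) z = bform S x z + bform S y z.
Proof. by rewrite /bform linearD /= !mulmxDl mxE. Qed.

Lemma bformZl n (S : 'M[R]_n) a x y : bform S (a *: x) y = a * bform S x y.
Proof. by rewrite /bform linearZ /= -!scalemxAl mxE. Qed.

Lemma qformZ n (S : 'M[R]_n) a x : qform S (a *: x) = a ^+ 2 * qform S x.
Proof. by rewrite -![qform _ _]/(bform _ _ _) bformZl bformZr mulrA expr2. Qed.

Lemma enormZ n a (x : 'cV[R]_n) : enorm (a *: x) = `|a| * enorm x.
Proof.
apply: (@pexpIrn _ 2); rewrite ?nnegrE ?mulr_ge0 ?enorm_ge0//.
by rewrite exprMn -!qform1 qformZ real_normK ?num_real.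
Qed.

Lemma enorm0 n : enorm (0 : 'cV[R]_n) = 0.
Proof. by rewrite -(scale0r 0) enormZ normr0 mul0r. Qed.

(** For c > 0 the value at the vertex t = - b / c is (a c - b^2) / c; for c < 0 the hypothesis is
    contradictory, and for c = 0 it forces b = 0. *)
Lemma discr_le (a b c : R) :
  (forall t, 0 <= a + 2 * t * b + t ^+ 2 * c) -> b ^+ 2 <= a * c.
Proof.
move=> H; have a0 : 0 <= a by have := H 0; rewrite mulr0 mul0r expr0n mul0r !addr0.
have [c0|c0|c0] := ltgtP c 0.
(* With |t| = 1 - r and the sign of t chosen so that t b <= 0, the polynomial is at most (1 - r +
   r^2) c < 0. *)
- exfalso; pose r := a / c.
  have ar : a = r * c by rewrite divfK// lt_eqF.
  have r0 : r <= 0 by rewrite mulr_ge0_le0// invr_le0 ltW.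
  have rc : (1 - r + r ^+ 2) * c < 0.
    by rewrite pmulr_rlt0// (_ : 0 < _)//; nra.
  have [b0|b0] := leP 0 b.
    by have := H (- (1 - r)); nra.
  by have := H (1 - r); nra.
- have := H (- b / c).
  have -> : a + 2 * (- b / c) * b + (- b / c) ^+ 2 * c = (a * c - b ^+ 2) / c.
    by field; rewrite gt_eqF.
  by rewrite pmulr_lge0 ?invr_gt0// subr_ge0.
- rewrite c0 mulr0; have [->|b0] := eqVneq b 0; first by rewrite expr0n.
  have := H (- (a + 1) / (2 * b)); rewrite c0.
  have -> : a + 2 * (- (a + 1) / (2 * b)) * b + (- (a + 1) / (2 * b)) ^+ 2 * 0 = -1.
    by field.
  by rewrite ler0N1.
Qed.

(** Discriminant of t |-> [qform S (x + t *: y)]. Semidefiniteness is the right generality: below it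
    is applied to sup E - P, which turns out to be singular. *)
Lemma psd_cauchy_schwarz n (S : 'M[R]_n) x y : S^T = S ->
  (forall z, 0 <= qform S z) -> bform S x y ^+ 2 <= qform S x * qform S y.
Proof.
move=> Ssym Spsd; apply: discr_le => t; have := Spsd (x + t *: y).
rewrite -![qform _ _]/(bform _ _ _) !(bformDl, bformDr, bformZl, bformZr).
by rewrite (bformC y x)//; congr (_ <= _); ring.
Qed.

Lemma cauchy_schwarz n (x y : 'cV[R]_n) :
  `|(x^T *m y) 0 0| <= enorm x * enorm y.
Proof.
rewrite -(@ler_pXn2r _ 2)// ?nnegrE ?mulr_ge0 ?enorm_ge0//.
rewrite real_normK ?num_real// exprMn -!qform1.
have := @psd_cauchy_schwarz n 1%:M x y (trmx1 _ _); rewrite /bform mulmx1; apply.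
by move=> z; rewrite qform1 sqr_ge0.
Qed.

Lemma ler_enormD n (x y : 'cV[R]_n) : enorm (x + y) <= enorm x + enorm y.
Proof.
rewrite -(@ler_pXn2r _ 2)// ?nnegrE ?addr_ge0 ?enorm_ge0//.
have := le_trans (ler_norm _) (cauchy_schwarz x y).
rewrite sqrrD -!qform1 -![qform _ _]/(bform _ _ _) bformDl !bformDr.
rewrite (bformC y x) ?trmx1// /bform mulmx1; lra.
Qed.

(** Cauchy-Schwarz on each row, with C the Frobenius norm. This bounds the set whose supremum
    defines [opnorm]. *)
Lemma enorm_mulmx_le m n (A : 'M[R]_(m, n)) :
  exists2 C, 0 <= C & forall x, enorm (A *m x) <= C * enorm x.
Proof.
exists (Num.sqrt (\sum_i enorm (row i A)^T ^+ 2)) => [|x]; first exact: sqrtr_ge0.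
have S0 : 0 <= \sum_i enorm (row i A)^T ^+ 2.
  by rewrite sumr_ge0// => i _; exact: sqr_ge0.
rewrite -(@ler_pXn2r _ 2)// ?nnegrE ?mulr_ge0 ?enorm_ge0 ?sqrtr_ge0//.
rewrite exprMn (sqr_sqrtr S0) [in leLHS]/enorm sqr_sqrtr; last first.
  by rewrite sumr_ge0// => i _; exact: sqr_ge0.
rewrite mulr_suml ler_sum// => i _; rewrite -exprMn.
have /= := cauchy_schwarz (row i A)^T x; rewrite trmxK -row_mul mxE => Aix.
rewrite -[_ ^+ 2]real_normK ?num_real//.
by rewrite ler_pXn2r// nnegrE ?mulr_ge0 ?enorm_ge0.
Qed.

Lemma opnorm_bound m n (A : 'M[R]_(m, n)) x :
  enorm (A *m x) <= opnorm A * enorm x.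
Proof.
have [C C0 AC] := enorm_mulmx_le A.
have [->|x0] := eqVneq x 0; first by rewrite mulmx0 !enorm0 mulr0.
rewrite -ler_pdivrMr ?enorm_gt0//.
have xg := enorm_gt0 x0.
have -> : enorm (A *m x) / enorm x = enorm (A *m ((enorm x)^-1 *: x)).
  by rewrite -scalemxAr enormZ ger0_norm ?invr_ge0 ?enorm_ge0// mulrC.
apply: ub_le_sup.
  exists C => _ [y /= y1 <-]; apply: le_trans (AC y) _.
  by rewrite -[leRHS]mulr1 ler_wpM2l.
exists ((enorm x)^-1 *: x) => //=.
by rewrite enormZ ger0_norm ?invr_ge0 ?enorm_ge0// mulVf// gt_eqF.
Qed.

Lemma mulmx_neq0 m n (A : 'M[R]_(m, n)) :
  A != 0 -> exists x : 'cV[R]_n, A *m x != 0.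
Proof.
move=> A0; apply/not_existsP => H; case/eqP: A0; apply/matrixP => i j.
have /negP := H (delta_mx j 0); rewrite negbK -colE => /eqP /matrixP /(_ i 0).
by rewrite !mxE.
Qed.

Lemma opnorm_gt0 m n (A : 'M[R]_(m, n)) : A != 0 -> 0 < opnorm A.
Proof.
move=> /mulmx_neq0[x Ax0].
have := opnorm_bound A x; have := enorm_gt0 Ax0; have := enorm_ge0 x.
move=> x0 Axp /(lt_le_trans Axp); rewrite pmulr_lgt0//.
rewrite lt_neqAle x0 andbT eq_sym; apply: contra_neq Ax0 => /enorm_eq0 ->.
by rewrite mulmx0.
Qed.

(** By symmetry the difference factors as (y - x)^T S (y + x). *)
Lemma qform_lipschitz n (S : 'M[R]_n) : S^T = S -> exists2 C, 0 <= C &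
  forall x y, `|qform S y - qform S x| <= C * (enorm x + enorm y) * enorm (y - x).
Proof.
move=> Ssym; have [C C0 SC] := enorm_mulmx_le S; exists C => // x y.
have -> : qform S y - qform S x = ((y - x)^T *m (S *m (y + x))) 0 0.
  rewrite mulmxA -[RHS]/(bform _ _ _) -![qform _ _]/(bform _ _ _).
  rewrite -(scaleN1r x) bformDl !bformDr !bformZl (bformC y x)//; ring.
apply: le_trans (cauchy_schwarz _ _) _; rewrite mulrC ler_wpM2r ?enorm_ge0//.
apply: le_trans (SC _) _; rewrite ler_wpM2l// addrC; exact: ler_enormD.
Qed.

Lemma posdef_unitmx n (P : 'M[R]_n) : posdef P -> P \in unitmx.
Proof.
move=> Ppos; rewrite unitmxE unitfE; apply/negP => /det0P[v v0 vP].
have := Ppos v^T; rewrite /qform trmxK vP mul0mx mxE ltxx.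
rewrite -(inj_eq trmx_inj) trmxK trmx0 => /(_ v0); by [].
Qed.

(* At the supremum s of the Rayleigh quotient, s - P is positive semidefinite
   but not bounded below by a multiple of the identity, hence singular. *)
Lemma qform_le_lambda_max n (P : 'M[R]_n) : P^T = P ->
  forall x, qform P x <= lambda_max P * enorm x ^+ 2.
Proof.
move=> Psym x; have [->|x0] := eqVneq x 0.
  by rewrite enorm0 expr0n mulr0 /qform mulmx0 mxE.
have [C C0 PC] := enorm_mulmx_le P.
pose E := [set qform P y | y in [set y | enorm y = 1]].
have En y : y != 0 -> E (qform P y / enorm y ^+ 2).
  move=> y0; exists ((enorm y)^-1 *: y) => /=.
    by rewrite enormZ ger0_norm ?invr_ge0 ?enorm_ge0// mulVf// gt_eqF ?enorm_gt0.
  by rewrite qformZ exprVn mulrC.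
have Eub : has_ubound E.
  exists C => _ [y /= y1 <-]; rewrite /qform -mulmxA.
  apply: le_trans (ler_norm _) (le_trans (cauchy_schwarz _ _) _).
  by rewrite y1 mul1r -[leRHS]mulr1 -y1; exact: PC.
have E0 : E !=set0 by exists (qform P x / enorm x ^+ 2); exact: En.
have sE y : qform P y <= sup E * enorm y ^+ 2.
  have [->|y0] := eqVneq y 0.
    by rewrite enorm0 expr0n mulr0 /qform mulmx0 mxE.
  rewrite -ler_pdivrMr ?exprn_gt0 ?enorm_gt0//; apply: ub_le_sup => //; exact: En.
pose S := (sup E)%:M - P.
have qS y : qform S y = sup E * enorm y ^+ 2 - qform P y.
  rewrite enormE /qform /S mulmxBr mulmxBl mxE [X in _ + X]mxE.
  by rewrite mul_mx_scalar -scalemxAl mxE.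
have Ssym : S^T = S by rewrite /S linearB /= tr_scalar_mx Psym.
have Spsd y : 0 <= qform S y by rewrite qS subr_ge0.
have eigP : eigenvalue P (sup E).
  apply/eigenvalueP; suff : ~~ (S \in unitmx).
    rewrite unitmxE unitfE negbK => /det0P[v v0 vS]; exists v => //.
    by apply/esym/eqP; rewrite -subr_eq0 -mul_mx_scalar -mulmxBr; exact/eqP.
  apply/negP => Su; have [c c0 Sc] := enorm_mulmx_le (invmx S).
  (* Cauchy-Schwarz for the form S, applied to y and S^-1 y, gives |y|^4 <= (y^T S y)(y^T S^-1 y),
     and the last factor is at most c |y|^2. *)
  have coer y : enorm y ^+ 2 <= c * qform S y.
    have [->|y0] := eqVneq y 0.
      by rewrite enorm0 expr0n mulr_ge0.
    have := psd_cauchy_schwarz y (invmx S *m y) Ssym Spsd.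
    have -> : bform S y (invmx S *m y) = enorm y ^+ 2.
      by rewrite /bform -mulmxA mulKVmx// enormE.
    have -> : qform S (invmx S *m y) = (y^T *m (invmx S *m y)) 0 0.
      rewrite /qform -mulmxA mulKVmx//.
      by have := bformC (invmx S *m y) y (trmx1 R n); rewrite /bform !mulmx1.
    move=> H.
    have := le_trans (ler_norm _) (cauchy_schwarz y (invmx S *m y)).
    move=> /le_trans/(_ (ler_wpM2l (enorm_ge0 _) (Sc _))).
    rewrite mulrCA -expr2 => bce.
    rewrite -(ler_pM2r (exprn_gt0 2 (enorm_gt0 y0))) -expr2 (le_trans H)//.
    by rewrite mulrAC [leLHS]mulrC ler_wpM2r.
  have c1 : 0 < c.
    rewrite lt_neqAle c0 andbT; apply/eqP => c1; have := coer x.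
    by rewrite -c1 mul0r leNgt exprn_gt0// enorm_gt0.
  (* On unit vectors coercivity pushes every Rayleigh value down to sup E - 1/c, against the
     definition of the supremum. *)
  suff : sup E <= sup E - c^-1 by rewrite lerBrDr gerDl invr_le0 leNgt c1.
  apply: ge_sup => // _ [y /= y1 <-]; have := coer y; rewrite qS y1 expr1n mulr1.
  by rewrite -ler_pdivrMl// mulr1; lra.
apply: le_trans (sE x) _; rewrite ler_wpM2r ?sqr_ge0//; apply: ub_le_sup => //=.
(* The eigenvalues must be bounded for [lambda_max] to dominate sup E. Eigenvectors are row vectors
   here, hence the transposes. *)
exists (sup E) => a /= /eigenvalueP[v vP v0].
have vt0 : v^T != 0 by rewrite -(inj_eq trmx_inj) trmxK trmx0.
have := sE v^T; rewrite /qform trmxK vP -scalemxAl mxE enormE trmxK.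
by rewrite ler_pM2r// -[v in v *m _]trmxK -enormE exprn_gt0// enorm_gt0.
Qed.

End EuclideanForms.

(** * Absolutely continuous real functions and their almost everywhere derivative *)

Section AbsolutelyContinuous.
Context {R : realType}.
Local Notation mu := (@lebesgue_measure R).

Definition ac_fun (a b : R) (f : R -> R) : Prop :=
  forall e : R, 0 < e -> exists2 d : R, 0 < d &
    forall (N : nat) (u v : 'I_N -> R),
      (forall i, a <= u i /\ u i <= v i /\ v i <= b) ->
      trivIset setT (fun i => [set` `]u i, v i[]) ->
      \sum_(i < N) (v i - u i) < d ->
      \sum_(i < N) `|f (v i) - f (u i)| < e.

Lemma ac_fun_sub a b a' b' f : a <= a' -> b' <= b ->
  ac_fun a b f -> ac_fun a' b' f.
Proof.
move=> aa bb acf e /acf[d d0 H]; exists d => // N u v uv; apply: H => i.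
by have [? [? ?]] := uv i; split; [exact: le_trans aa _|split=> //; exact: le_trans bb].
Qed.

Lemma ac_fun_uniform a b f : ac_fun a b f -> forall e, 0 < e ->
  exists2 d, 0 < d & forall s t, a <= s <= b -> a <= t <= b ->
    `|t - s| < d -> `|f t - f s| < e.
Proof.
move=> acf e /acf[d d0 H]; exists d => // s t.
wlog st : s t / s <= t.
  move=> W sab tab tsd; have [/W|/ltW ts] := leP s t; first exact.
  by rewrite distrC; apply: W => //; rewrite distrC.
move=> /andP[sa sb] /andP[ta tb] tsd.
have := H 1%N (fun=> s) (fun=> t); rewrite !big_ord1; apply => //.
- by move=> i j _ _ _; rewrite !ord1.
- by rewrite (le_lt_trans (ler_norm _)).
Qed.

(** Outer regularity makes U minus A small for a measurable null set A containing N, and A adds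
    nothing to the measure of U. *)
Lemma negligible_open_cover (N : set R) (e : R) : mu.-negligible N -> 0 < e ->
  exists U : set R, [/\ open U, N `<=` U & (mu U < e%:E)%E].
Proof.
move=> [A [mA A0 NA]] e0.
have [|U [Uo AU UA]] := lebesgue_regularity_outer mA _ e0; first by rewrite -[X in (X < _)%E]/(mu A) A0.
exists U; split => //; first exact: subset_trans AU.
have mU : measurable U by exact: measurable_realfun.open_measurable.
rewrite (le_lt_trans _ UA)// -[in leLHS](setDUK AU) setUC.
have := measureU2 mu (measurableD mU mA) mA; rewrite [X in (_ <= _ + X)%E]A0 adde0; exact.
Qed.

Lemma lebesgue_sum_itv_le (U : set R) N (u v : 'I_N -> R) :
  measurable U -> (forall i, u i <= v i) ->
  (forall i, [set` `]u i, v i[] `<=` U) ->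
  trivIset setT (fun i => [set` `]u i, v i[]) ->
  ((\sum_(i < N) (v i - u i))%:E <= mu U)%E.
Proof.
move=> mU uv uvU tuv.
have -> : ((\sum_(i < N) (v i - u i))%:E =
    mu (\big[setU/set0]_(i < N) [set` `]u i, v i[]))%E.
  rewrite measure_bigsetU_ord// -sumEFin; apply: eq_bigr => i _.
  rewrite [RHS](lebesgue_measure_itv `]u i, v i[) /= lte_fin; have := uv i.
  by rewrite le_eqVlt => /orP[/eqP->|->//]; rewrite ltxx subrr.
apply: le_measure; rewrite ?inE//; first exact: bigsetU_measurable.
by elim/big_ind : _ => // X Y XU YU x [/XU|/YU].
Qed.

(** Subtract the first order estimates at v and at u: since t lies between them, the errors e (v -
    t) and e (t - u) add up to e (v - u). *)
Lemma is_derive_straddle (f : R -> R) (t l e : R) : is_derive t 1 f l -> 0 < e ->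
  exists2 d, 0 < d & forall u v, t - d < u -> u <= t -> t <= v -> v < t + d ->
    f v - f u <= (l + e) * (v - u).
Proof.
move=> [df fl] e0.
have /cvgrPdist_lt/(_ _ e0)[d /= d0 H] : h^-1 *: (f (h *: 1 + t) - f t) @[h --> 0^'] --> l.
  by rewrite -fl; exact: df.
have {}H s : `|s - t| < d -> `|f s - f t - l * (s - t)| <= e * `|s - t|.
  move=> st; have [->|] := eqVneq s t; first by rewrite !subrr mulr0 subr0 normr0 mulr0.
  rewrite -subr_eq0 => st0.
  have := H (s - t); rewrite /ball_ /= sub0r normrN => /(_ st st0).
  rewrite scaler1 subrK distrC => /ltW.
  rewrite -(ler_pM2r (_ : 0 < `|s - t|)) ?normr_gt0// -normrM mulrBl.
  by rewrite mulrAC mulVf// mul1r.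
exists d => // u v tu ut tv vt.
have := H u; have := H v.
rewrite (ger0_norm (_ : 0 <= v - t)) ?subr_ge0// (ler0_norm (_ : u - t <= 0)) ?subr_le0//.
rewrite ltrBlDl ltrNl => /(_ vt); rewrite ler_norml => /andP[_ Hv] Hu.
have /Hu : - d < u - t by lra.
rewrite ler_norml => /andP[Hu' _]; lra.
Qed.

(* Cover the exceptional null set by an open set U of small measure, and extend
   from left to right a subdivision whose intervals either lie in U, where
   absolute continuity bounds the total increase of f, or are short enough
   around a point t outside U for f' t to bound the increase of f. *)
Lemma ac_fun_increment_le (a b k : R) (f : R -> R) : a <= b -> ac_fun a b f ->
  {ae mu, forall t, a < t < b -> exists2 l, is_derive t 1 f l & l <= k} ->
  f b - f a <= k * (b - a).
Proof.
move=> ab acf aef; apply/ler_addgt0Pl => z z0.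
(* The total error is at most e w: e (b - a) from the slope k + e, e from absolute continuity, and
   (|k| + 1) e from |k + e| times the length of the intervals in U. *)
pose w := b - a + `|k| + 2.
have w0 : 0 < w by rewrite /w; have := normr_ge0 k; lra.
pose e := Num.min 1 (z / w).
have e0 : 0 < e by rewrite lt_min ltr01 divr_gt0.
have e1 : e <= 1 by rewrite ge_min lexx.
have ew : e * w <= z by rewrite -ler_pdivlMr// ge_min lexx orbT.
have [d d0 acd] := acf _ e0.
(* The endpoints go into U as well, since the derivative is controlled only on the open interval. *)
have [U [Uo NU muU]] : exists U : set R, [/\ open U,
    (~` [set t | a < t < b -> exists2 l, is_derive t 1 f l & l <= k])
    `|` ([set a] `|` [set b]) `<=` U & (mu U < (Num.min d e)%:E)%E].
  apply: negligible_open_cover; last by rewrite lt_min d0.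
  apply: negligibleU => //; apply: negligibleU;
    by apply/negligibleP => //; exact: lebesgue_measure_set1.
(* Only the intervals of the subdivision lying in U are recorded. The term in |k + e| compensates
   for (k + e) (c - a) also counting their length, possibly with a negative sign. *)
pose good c := a <= c <= b /\ exists N (u v : nat -> R), [/\
  forall i, (i < N)%N -> [/\ a <= u i, u i <= v i & v i <= c],
  forall i, (i < N)%N -> [set` `]u i, v i[] `<=` U,
  forall i j, (i < j < N)%N -> v i <= u j &
  f c - f a <= (k + e) * (c - a) +
    \sum_(i < N) (`|f (v i) - f (u i)| + `|k + e| * (v i - u i))].
have good_step c c' : good c -> c <= c' <= b ->
    [set` `]c, c'[] `<=` U \/ f c' - f c <= (k + e) * (c' - c) -> good c'.
  move=> [/andP[ac cb] [N [u [v [uv uvU tuv fc]]]]] /andP[cc' c'b] stp.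
  split; first by rewrite c'b (le_trans ac).
  have [cU|fcc'] := stp.
    exists N.+1, (fun i => if i == N then c else u i),
      (fun i => if i == N then c' else v i); split.
    - move=> i; rewrite ltnS leq_eqVlt; case: eqP => [_ _|_ /= /uv[? ? vc]].
        by split.
      by split => //; exact: le_trans vc _.
    - by move=> i; rewrite ltnS leq_eqVlt; case: eqP => [//|_ /= /uvU].
    - move=> i j; rewrite ltnS => /andP[ij jN].
      have iN := leq_trans ij jN.
      rewrite (ltn_eqF iN); case: eqP => [_|/eqP jN'].
        by have [] := uv i iN.
      by apply: tuv; rewrite ij ltn_neqAle jN'.
    - rewrite big_ord_recr /= eqxx.
      under eq_bigr => i _ do rewrite (ltn_eqF (ltn_ord i)).
      have := ler_norm (f c' - f c); have : 0 <= c' - c by rewrite subr_ge0.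
      have := ler_norm (- (k + e)); rewrite normrN => h1 h2 h3.
      have := mulr_ge0 (_ : 0 <= (k + e) + `|k + e|) h2.
      by move=> /(_ ltac:(lra)); lra.
  exists N, u, v; split => //; last lra.
  by move=> i /uv[? ? vc]; split => //; exact: le_trans vc _.
have gooda : good a.
  split; first by rewrite lexx.
  exists 0%N, (fun=> 0), (fun=> 0); split => //.
  by rewrite !subrr mulr0 big_ord0 addr0.
have goodub : ubound good b by move=> c [/andP[]].
(* Real induction: the supremum of the good points is shown to be b and to be good. *)
pose c := sup good.
have ac : a <= c by apply: ub_le_sup => //; exists b.
have cb : c <= b by apply: ge_sup => //; exists a.
have [r r0 Hr] : exists2 r, 0 < r & forall u v, c - r < u -> u <= c -> c <= v ->
    v < c + r -> [set` `]u, v[] `<=` U \/ f v - f u <= (k + e) * (v - u).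
  have [cU|cU] := pselect (U c).
    have /nbhs_ballP[r r0 rU] := open_nbhs_nbhs (conj Uo cU).
    exists r => // u v cu uc cv vc; left => x /=; rewrite in_itv /= => /andP[ux xv].
    by apply: rU; rewrite /ball /= ltr_distl; apply/andP; split; lra.
  have : a < c < b -> exists2 l, is_derive c 1 f l & l <= k.
    by apply: contrapT => ?; apply: cU; apply: NU; left.
  have ca : c != a by apply/eqP => ca; apply: cU; apply: NU; right; left.
  have cb' : c != b by apply/eqP => cb'; apply: cU; apply: NU; right; right.
  move=> /(_ _)[|l fl lk]; first by rewrite !lt_neqAle eq_sym ca cb' ac.
  have [r r0 H] := is_derive_straddle fl e0; exists r => // u v cu uc cv vc; right.
  apply: le_trans (H u v cu uc cv vc) _; rewrite ler_wpM2r// ?lerD2r//.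
  by rewrite subr_ge0 (le_trans uc).
(* One step from a good x just left of c to y, at or beyond c, makes y good; as c + r / 2 exceeds c,
   this is possible only if y = b. *)
have [x gx cx] : exists2 x, good x & c - r < x.
  by apply: sup_adherent => //; split; [exists a|exists b].
have xc : x <= c by apply: ub_le_sup => //; exists b.
pose y := Num.min b (c + r / 2).
have cy : c <= y by rewrite le_min cb lerDl divr_ge0// ltW.
have yb : y <= b by rewrite ge_min lexx.
have gy : good y.
  apply: (good_step _ _ gx); first by rewrite (le_trans xc)//.
  apply: Hr => //; rewrite gt_min; apply/orP; right; rewrite ltrD2l; lra.
have : y <= c by apply: ub_le_sup => //; exists b.
rewrite ge_min => /orP[bc|]; last by move=> ?; exfalso; lra.
have yb' : y = b by apply/le_anti; rewrite yb (le_trans bc).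
move: gy; rewrite yb' => -[_ [N [u [v [uv uvU tuv fb]]]]].
have tI : trivIset setT (fun i : 'I_N => [set` `]u i, v i[]).
  move=> i j _ _ [s [/=]]; rewrite !in_itv /= => /andP[us sv] /andP[us' sv'].
  apply/val_inj => /=; have [ij|ij|//] := ltngtP i j; exfalso.
    by have := tuv i j; rewrite ij ltn_ord => /(_ isT); lra.
  by have := tuv j i; rewrite ij ltn_ord => /(_ isT); lra.
have suv : \sum_(i < N) (v i - u i) < Num.min d e.
  rewrite -lte_fin (le_lt_trans _ muU)//.
  apply: (@lebesgue_sum_itv_le U N (fun i => u i) (fun i => v i)) => //.
  - exact: measurable_realfun.open_measurable.
  - by move=> i; have [] := uv i (ltn_ord i).
  - by move=> i; exact: uvU.
move: suv; rewrite lt_min => /andP[sd se].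
have sf := acd N (fun i => u i) (fun i => v i) (fun i =>
  let: And3 h1 h2 h3 := uv i (ltn_ord i) in conj h1 (conj h2 h3)) tI sd.
move: fb; rewrite big_split /= -mulr_sumr => fb.
have : `|k + e| * \sum_(i < N) (v i - u i) <= (`|k| + 1) * e.
  rewrite ler_pM//; last exact: ltW.
    by rewrite sumr_ge0// => i _; rewrite subr_ge0; have [] := uv i (ltn_ord i).
  by rewrite (le_trans (ler_normD _ _))// lerD2l gtr0_norm.
by move: ew sf; rewrite /w /=; lra.
Qed.

End AbsolutelyContinuous.

(** * Barrier and reaching-time arguments for scalar functions *)

Section Barrier.
Context {R : realType}.
Local Notation mu := (@lebesgue_measure R).

Lemma lebesgue_aeS (P Q : R -> Prop) : (forall t, P t -> Q t) ->
  {ae mu, forall t, P t} -> {ae mu, forall t, Q t}.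
Proof. by move=> PQ [A [mA A0 PA]]; exists A; split => // t nQ; apply: PA => /PQ. Qed.

Lemma ac_fun_le_max (a b : R) f : a <= b -> ac_fun a b f ->
  exists C, forall t, a <= t <= b -> f t <= C.
Proof.
move=> ab acf; have [|c _ H] := @EVT_max R f a b ab; last first.
  by exists (f c) => t tab; apply: H; rewrite in_itv.
apply/subspace_continuousP => t /=; rewrite in_itv /= => tab.
apply/cvgrPdist_lt => e e0; have [d d0 H] := ac_fun_uniform acf e0.
apply/nbhs_ballP; exists d => // s /= ts; rewrite in_itv /= => sab.
by apply: H => //; rewrite distrC in ts *.
Qed.

(** The derivative is controlled only shortly after each time s with f s <= c, because the field is
    controlled only near the region. The last such s before a violation suffices. *)
Lemma ac_fun_barrier (t0 c : R) (f : R -> R) : (forall t1, ac_fun t0 t1 f) ->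
  f t0 <= c ->
  (forall s, t0 <= s -> f s <= c -> exists2 d, 0 < d &
    {ae mu, forall t, s < t < s + d -> c < f t ->
      exists2 l, is_derive t 1 f l & l <= 0}) ->
  forall t, t0 <= t -> f t <= c.
Proof.
move=> acf ft0 inward t1 t01; rewrite leNgt; apply/negP => cft1.
pose E := [set t | t0 <= t <= t1 /\ f t <= c].
have Et0 : E t0 by split; rewrite ?lexx.
have Eub : ubound E t1 by move=> t [/andP[]].
pose s := sup E.
have t0s : t0 <= s by apply: ub_le_sup => //; exists t1.
have st1 : s <= t1 by apply: ge_sup => //; exists t0.
(* By continuity the supremum is itself a time at which f is at most c. *)
have fs : f s <= c.
  rewrite leNgt; apply/negP => cfs.
  have fsc : 0 < f s - c by rewrite subr_gt0.
  have [d d0 H] := ac_fun_uniform (acf t1) fsc.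
  have [t Et st] : exists2 t, E t & s - d < t.
    by apply: sup_adherent => //; split; [exists t0|exists t1].
  have ts : t <= s by apply: ub_le_sup => //; exists t1.
  have [t01' ft] := Et.
  have := H t s t01'; rewrite t0s st1 => /(_ isT).
  rewrite (ger0_norm (_ : 0 <= s - t)) ?subr_ge0// => /(_ ltac:(lra)).
  by move=> /(le_lt_trans (ler_norm _)); lra.
have lt_st1 : s < t1.
  by rewrite lt_neqAle st1 andbT; apply/eqP => st; move: fs; rewrite st leNgt cft1.
have [d d0 aef] := inward s t0s fs.
pose t2 := Num.min t1 (s + d).
have st2 : s < t2 by rewrite lt_min lt_st1 ltrDl.
have t21 : t2 <= t1 by rewrite ge_min lexx.
have notE t : s < t <= t1 -> c < f t.
  move=> /andP[st tt1]; rewrite ltNge; apply/negP => ftc.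
  have : t <= s.
    by apply: ub_le_sup; [exists t1|split => //; rewrite tt1 (le_trans t0s)// ltW].
  by rewrite leNgt st.
have : f t2 - f s <= 0 * (t2 - s).
  apply: ac_fun_increment_le; first exact: ltW.
    exact: (@ac_fun_sub _ t0 t1).
  apply: lebesgue_aeS aef => t H /andP[st tt2]; apply: H.
    by rewrite st (lt_le_trans tt2)// ge_min lexx orbT.
  by apply: notE; rewrite st (le_trans (ltW tt2)).
have := notE t2; rewrite st2 t21 => /(_ isT); rewrite mul0r; lra.
Qed.

(** If f stayed above c throughout, decrease at rate k for a time (c' - c) / k would bring it from
    at most c' to at most c. *)
Lemma ac_fun_reach (t0 c c' k : R) (f : R -> R) : (forall t1, ac_fun t0 t1 f) ->
  0 < k -> c < c' -> (forall t, t0 <= t -> f t <= c') ->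
  {ae mu, forall t, t0 < t -> c < f t ->
    exists2 l, is_derive t 1 f l & l <= - k} ->
  exists2 t, t0 <= t <= t0 + (c' - c) / k & f t <= c.
Proof.
move=> acf k0 cc' fc' aef; apply: contrapT => H.
have T0 : 0 <= (c' - c) / k by rewrite divr_ge0// ?subr_ge0 ltW.
have {}H t : t0 <= t <= t0 + (c' - c) / k -> c < f t.
  by move=> tT; rewrite ltNge; apply/negP => ftc; apply: H; exists t.
have : f (t0 + (c' - c) / k) - f t0 <= - k * (t0 + (c' - c) / k - t0).
  apply: ac_fun_increment_le => //; first by rewrite lerDl.
  apply: lebesgue_aeS aef => t Ht /andP[tt tT]; apply: Ht => //.
  by apply: H; rewrite !ltW.
have := H (t0 + (c' - c) / k); rewrite lerDl T0 lexx => /(_ isT).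
have := fc' t0 (lexx _).
have -> : - k * (t0 + (c' - c) / k - t0) = - (c' - c) by field; rewrite gt_eqF.
lra.
Qed.

End Barrier.

(** * Quadratic forms along trajectories *)

Section Trajectories.
Context {R : realType}.

Lemma ler_dist_enorm n (x y : 'cV[R]_n) : `|enorm x - enorm y| <= enorm (x - y).
Proof.
have enormB u v : enorm (u - v : 'cV[R]_n) = enorm (v - u).
  by rewrite -opprB -scaleN1r enormZ normrN1 mul1r.
have H u v : enorm (u : 'cV[R]_n) - enorm v <= enorm (u - v).
  by rewrite lerBlDr -{1}(subrK v u) ler_enormD.
by rewrite ler_norml H andbT lerNl opprB enormB H.
Qed.

Lemma abs_continuous_lipschitz n (a b C : R) (x : R -> 'cV[R]_n) (f : R -> R) :
  0 <= C -> abs_continuous a b x ->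
  (forall s t, a <= s <= b -> a <= t <= b ->
    `|f t - f s| <= C * enorm (x t - x s)) ->
  ac_fun a b f.
Proof.
(* C + 1 replaces C so that the division is legitimate when C = 0. *)
move=> C0 acx fx e e0; have C1 : 0 < C + 1 by rewrite ltr_wpDl.
have [d d0 H] := acx (e / (C + 1)) (divr_gt0 e0 C1).
exists d => // N u v uv tuv suv; have {H} := H N u v uv tuv suv.
rewrite ltr_pdivlMr// => /(le_lt_trans _); apply.
rewrite mulrDr mulr1 ler_wpDr//; first by rewrite sumr_ge0// => i _; exact: enorm_ge0.
rewrite mulrC mulr_sumr ler_sum// => i _; have [au [uvi vb]] := uv i.
by apply: fx; rewrite ?au ?vb ?(le_trans au) ?(le_trans uvi).
Qed.

Lemma abs_continuous_dist n (a b : R) (x : R -> 'cV[R]_n) y :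
  abs_continuous a b x -> ac_fun a b (fun t => enorm (x t - y)).
Proof.
move=> acx; apply: (abs_continuous_lipschitz ler01 acx) => s t _ _.
rewrite mul1r (le_trans (ler_dist_enorm _ _))//.
by rewrite opprB addrA subrK.
Qed.

(** A trajectory is bounded on a compact interval, and a quadratic form is Lipschitz on bounded
    sets. If b < a, only the empty family of intervals occurs. *)
Lemma abs_continuous_qform n (P : 'M[R]_n) (a b : R) (x : R -> 'cV[R]_n) :
  P^T = P -> abs_continuous a b x -> ac_fun a b (fun t => qform P (x t)).
Proof.
move=> Psym acx; have [ab|ba] := leP a b; last first.
  move=> e e0; exists 1 => // N u v uv _ _; case: N u v uv => [u v _|N u v uv].
    by rewrite big_ord0.
  have [au [uvi vb]] := uv ord0; have := le_trans au (le_trans uvi vb).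
  by rewrite leNgt ba.
have [C C0 PC] := qform_lipschitz Psym.
have [B xB] := ac_fun_le_max ab (abs_continuous_dist 0 acx).
have {}xB t : a <= t <= b -> enorm (x t) <= B by move=> /xB; rewrite subr0.
have B0 : 0 <= B by rewrite (le_trans (enorm_ge0 (x a)))// xB// lexx.
apply: (abs_continuous_lipschitz (_ : 0 <= C * (B + B)) acx) => [|s t sab tab].
  by rewrite mulr_ge0// addr_ge0.
rewrite (le_trans (PC _ _))// ler_wpM2r ?enorm_ge0// ler_wpM2l// lerD// xB//.
Qed.

Lemma is_derive_coord n (x : R -> 'cV[R]_n) (t : R) v i :
  is_derive t 1 x v -> is_derive t 1 (fun s => x s i 0) (v i 0).
Proof.
move=> [dx xv]; have /derivable_mxP/(_ i 0)/derivableP := dx.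
by move: xv; rewrite derive_mx// => <-; rewrite mxE.
Qed.

Lemma qformE n (P : 'M[R]_n) x :
  qform P x = \sum_j (\sum_i P i j * x i 0) * x j 0.
Proof.
rewrite /qform mxE; apply: eq_bigr => j _; congr (_ * _).
by rewrite mxE; apply: eq_bigr => i _; rewrite mxE mulrC.
Qed.

Lemma is_derive_qform n (P : 'M[R]_n) (x : R -> 'cV[R]_n) (t : R) v : P^T = P ->
  is_derive t 1 x v -> is_derive t 1 (fun s => qform P (x s)) (2 * bform P (x t) v).
Proof.
move=> Psym xv; pose X i := fun s => x s i 0.
have dX i : is_derive t 1 (X i) (v i 0) by exact: is_derive_coord.
(* As a sum of products of coordinate functions, the form is differentiated by instance
   inference. *)
have -> : (fun s => qform P (x s)) =
    \sum_j ((\sum_i (P i j \*: X i)) * X j).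
  apply/funext => s; rewrite qformE fct_sumE; apply: eq_bigr => j _.
  by rewrite /GRing.mul /= fct_sumE.
apply: is_derive_eq.
rewrite mulr_natl mulr2n {2}(bformC _ _ Psym) /bform !mxE -big_split /=.
apply: eq_bigr => j _; congr (_ + _).
  rewrite fct_sumE mxE; congr (_ * _); apply: eq_bigr => i _.
  by rewrite mxE mulrC.
rewrite mxE [LHS]mulrC; congr (_ * _); apply: eq_bigr => i _.
by rewrite mxE mulrC.
Qed.

Lemma continuous_qform n (P : 'M[R]_n) : continuous (qform P).
Proof.
rewrite (_ : qform P = fun x => \sum_j (\sum_i P i j * x i 0) * x j 0); last first.
  by apply/funext => x; rewrite qformE.
have cont_row j : continuous (fun x : 'cV[R]_n => \sum_i P i j * x i 0).
  apply: continuous_big => [|i _ x]; first exact: add_continuous.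
  apply: (@continuousM _ _ (cst (P i j)) (fun x : 'cV[R]_n => x i 0)).
    exact: cst_continuous.
  exact: coord_continuous.
apply: continuous_big => [|j _ x]; first exact: add_continuous.
apply: (@continuousM _ _ _ (fun x : 'cV[R]_n => x j 0)); first exact: cont_row.
exact: coord_continuous.
Qed.

Lemma interior_ellipsoid n (P : 'M[R]_n) c : 0 < c ->
  (ellipsoid P c)° = [set x | qform P x < c].
Proof.
move=> c0; apply/seteqP; split => x /=; last first.
  move=> xc; rewrite /interior.
  have : open (qform P @^-1` [set y | y < c]).
    by apply: open_comp => [y _|]; [exact: continuous_qform|exact: open_lt].
  by move=> oU; apply: (filterS _ (open_nbhs_nbhs (conj oU xc))) => y /ltW.
move=> /nbhs_ballP[r /= r0 xr]; have := xr x (ballxx _ r0).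
rewrite /ellipsoid /= le_eqVlt => /orP[/eqP xc|//]; exfalso.
(* Scaling a boundary point by 1 + a moves it by less than r but multiplies its value c > 0 by (1 +
   a)^2 > 1. *)
pose a := r / (2 * (`|x| + 1)).
have x1 : 0 < `|x| + 1 by rewrite ltr_wpDl.
have a0 : 0 < a by rewrite divr_gt0// mulr_gt0.
have : qform P ((1 + a) *: x) <= c.
  apply: xr; rewrite -ball_normE /ball_ /= scalerDl scale1r opprD addrA subrr.
  rewrite add0r normrN normrZ gtr0_norm// /a -mulrA.
  rewrite -[ltRHS]mulr1 ltr_pM2l// mulrC ltr_pdivrMr ?mulr_gt0// mul1r; lra.
rewrite qformZ xc leNgt => /negP; apply; rewrite ltr_pMl// exprn_egt1//.
by rewrite ltrDl.
Qed.

End Trajectories.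

(** * Lyapunov estimate and closed-loop solutions *)

Section ClosedLoop.
Context {R : realType}.
Local Notation mu := (@lebesgue_measure R).

Lemma lyapunov_derivative n p (A : 'M[R]_n) (B : 'M[R]_(n, p)) (K : 'M[R]_(p, n))
    (P : 'M[R]_n) y z : P^T = P ->
  (A + B *m K)^T *m P + P *m (A + B *m K) = - 1%:M ->
  2 * bform P y (A *m y + B *m K *m z) =
    - enorm y ^+ 2 + 2 * (y^T *m (P *m B *m K *m (z - y))) 0 0.
Proof.
move=> Psym lyap.
have -> : A *m y + B *m K *m z = (A + B *m K) *m y + B *m K *m (z - y).
  by rewrite mulmxDl mulmxBr addrACA subrr addr0.
rewrite bformDr mulrDr; congr (_ + _); last by rewrite /bform !mulmxA.
have := congr1 (fun S : 'M[R]_n => (y^T *m S *m y) 0 0) lyap.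
rewrite mulmxN mulNmx [RHS]mxE mulmx1 -enormE => <-.
rewrite mulmxDr mulmxDl [RHS]mxE mulr_natl mulr2n; congr (_ + _); last first.
  by rewrite /bform !mulmxA.
by rewrite bformC// /bform trmx_mul !mulmxA.
Qed.

(** The cross term is at most 2 |y| |PBK| |q(y) - y| <= c |y|^2. It is used with c = 1 - eps between
    the ellipsoids and with c = 1 outside R1. *)
Lemma lyapunov_derivative_le n p (A : 'M[R]_n) (B : 'M[R]_(n, p))
    (K : 'M[R]_(p, n)) (P : 'M[R]_n) (q : 'cV[R]_n -> 'cV[R]_n) c y :
  P^T = P -> (A + B *m K)^T *m P + P *m (A + B *m K) = - 1%:M ->
  0 < opnorm (P *m B *m K) -> y != 0 ->
  rel_error q y <= c / (2 * opnorm (P *m B *m K)) ->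
  2 * bform P y (A *m y + B *m K *m q y) <= - (1 - c) * enorm y ^+ 2.
Proof.
move=> Psym lyap; set L := opnorm _ => L0 y0 qy; have y1 := enorm_gt0 y0.
rewrite lyapunov_derivative//.
have := le_trans (ler_norm _) (cauchy_schwarz y (P *m B *m K *m (q y - y))).
have := opnorm_bound (P *m B *m K) (q y - y).
move: qy; rewrite /rel_error ler_pdivrMr// mulrAC ler_pdivlMr ?mulr_gt0// -/L.
set h := enorm (q y - y); set g := enorm (P *m B *m K *m _).
move=> hc gh; move: ((_ *m (_ *m _)) 0 0) => s sg.
have : enorm y * g <= enorm y * (L * h) by rewrite ler_pM2l.
have : enorm y * (h * (2 * L)) <= enorm y * (c * enorm y) by rewrite ler_pM2l.
by rewrite expr2; lra.
Qed.

(** The supremum is over a bounded set: q takes finitely many values on D, so the relative error is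
    at most the sum of their norms divided by r, plus 1. *)
Lemma rel_error_le_Delta n (D : set 'cV[R]_n) (q : 'cV[R]_n -> 'cV[R]_n)
    (S : set 'cV[R]_n) r x : quantizer D q -> S `<=` D -> 0 < r ->
  (forall y, S y -> r <= enorm y) -> S x -> rel_error q x <= Delta q S.
Proof.
move=> /finite_seqP[s qs] SD r0 Sr Sx; apply: ub_le_sup; last by exists x.
exists ((\sum_(z <- s) enorm z) / r + 1) => _ [y Sy <-].
have y0 : 0 < enorm y by exact: lt_le_trans r0 (Sr _ Sy).
have qys : enorm (q y) <= \sum_(z <- s) enorm z.
  have : q y \in s.
    suff : [set` s] (q y) by [].
    by rewrite -qs; exists y => //; exact: SD.
  move=> /(big_rem _) -> /=; rewrite lerDl sumr_ge0// => z _; exact: enorm_ge0.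
rewrite /rel_error ler_pdivrMr// mulrDl mul1r (le_trans (ler_enormD _ _))//.
rewrite -scaleN1r enormZ normrN1 mul1r lerD2r mulrAC ler_pdivlMr//.
by rewrite ler_pM ?enorm_ge0 ?(ltW r0)// Sr.
Qed.

Lemma closed_loop_qform n p (A : 'M[R]_n) (B : 'M[R]_(n, p)) (K : 'M[R]_(p, n))
    (P : 'M[R]_n) D q t0 x : P^T = P -> closed_loop_solution A B K D q t0 x ->
  (forall t1, ac_fun t0 t1 (fun t => qform P (x t))) /\
  {ae mu, forall t, t0 < t -> D (x t) /\
    is_derive t 1 (fun s => qform P (x s))
      (2 * bform P (x t) (A *m x t + B *m K *m q (x t)))}.
Proof.
move=> Psym [acx xt]; split=> [t1|]; first exact: abs_continuous_qform.
by apply: lebesgue_aeS xt => t H /H[Dx dx]; split => //; exact: is_derive_qform.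
Qed.

Lemma abs_continuous_near n (t0 s : R) (x : R -> 'cV[R]_n) (U : set 'cV[R]_n) :
  (forall t1, abs_continuous t0 t1 x) -> open U -> t0 <= s -> U (x s) ->
  exists2 d, 0 < d & forall t, s <= t < s + d -> U (x t).
Proof.
move=> acx Uo t0s Us.
have /nbhs_ballP[r /= r0 rU] := open_nbhs_nbhs (conj Uo Us).
have [d d0 H] := ac_fun_uniform (abs_continuous_dist (x s) (acx (s + 1))) r0.
exists (Num.min 1 d); first by rewrite lt_min ltr01.
move=> t /andP[st]; rewrite -ltrBlDl lt_min => /andP[t1 td].
have ts1 : t <= s + 1 by lra.
have := H s t; rewrite t0s lerDl ler01 ts1 (le_trans t0s st) => /(_ isT isT).
rewrite ger0_norm ?subr_ge0// => /(_ td); rewrite subrr enorm0 subr0.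
(* The topology is that of the max norm, and each coordinate is bounded by the Euclidean norm. *)
rewrite ger0_norm ?enorm_ge0// => xr; apply: rU; split => // i j.
rewrite ord1 -ball_normE /ball_ /= distrC (le_lt_trans _ xr)//.
by have := le_coord_enorm (x t - x s) i; rewrite !mxE.
Qed.

End ClosedLoop.

Unset Implicit Arguments.
Set Strict Implicit.
Set Printing Implicit Defensive.

Theorem lemma4 (R : realType) (n p : nat)
  (A : 'M[R]_n) (B : 'M[R]_(n, p)) (K : 'M[R]_(p, n))
  (hurw : hurwitz (A + B *m K)) (BK0 : B *m K != 0)
  (P : 'M[R]_n) (Psym : P^T = P) (Ppos : posdef P)
  (lyap : (A + B *m K)^T *m P + P *m (A + B *m K) = - 1%:M)
  (M m : R) (m0 : 0 < m) (mM : m < M)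
  (D : set 'cV[R]_n) (q : 'cV[R]_n -> 'cV[R]_n) (eps : R) (eps0 : 0 < eps) :
  let R1 := ellipsoid P (lambda_min P * M ^+ 2) in
  let R2 := ellipsoid P (lambda_max P * m ^+ 2) in
  let T := (lambda_min P * M ^+ 2 - lambda_max P * m ^+ 2) / (m ^+ 2 * eps) in
  quantizer D q -> R1 `<=` D ->
  lambda_min P * M ^+ 2 > lambda_max P * m ^+ 2 ->
  Delta q (R1 `\` R2) <= (1 - eps) / (2 * opnorm (P *m B *m K)) ->
  [/\ invariant_region A B K D q R2,
      invariant_region A B K D q R1°,
      reaches_within A B K D q R1° R2 T &
      error_bound_past D q R1 (1 / (2 * opnorm (P *m B *m K))) ->
        invariant_region A B K D q R1 /\ reaches_within A B K D q R1 R2 T].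

Proof.
set c1 := lambda_min P * M ^+ 2; set c2 := lambda_max P * m ^+ 2.
set L := opnorm (P *m B *m K).
move=> R1 R2 T qD R1D c21 Delta_le.
have L0 : 0 < L.
  apply: opnorm_gt0; apply: contra_neq BK0; rewrite -mulmxA => PBK.
  by rewrite -(mulKmx (posdef_unitmx Ppos) (B *m K)) PBK mulmx0.
(* A vector not killed by BK is nonzero, which rules out n = 0. *)
have lmax0 : 0 < lambda_max P.
  have [z BKz] := mulmx_neq0 BK0.
  have z0 : z != 0 by apply: contra_neq BKz => ->; rewrite mulmx0.
  have := lt_le_trans (Ppos z z0) (qform_le_lambda_max Psym z).
  by rewrite pmulr_lgt0// exprn_gt0// enorm_gt0.
have c20 : 0 < c2 by rewrite mulr_gt0// exprn_gt0.
have c10 : 0 < c1 by exact: lt_trans c21.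
have enorm_gt y : c2 < qform P y -> m < enorm y.
  move=> /lt_le_trans/(_ (qform_le_lambda_max Psym y)); rewrite ltr_pM2l//.
  by rewrite ltr_pXn2r ?nnegrE ?enorm_ge0 ?(ltW m0).
have neq0 y : c2 < qform P y -> y != 0.
  by move=> /enorm_gt my; apply: contraTneq my => ->; rewrite enorm0 -leNgt ltW.
have rate y : c2 < qform P y <= c1 ->
    2 * bform P y (A *m y + B *m K *m q y) <= - (m ^+ 2 * eps).
  move=> /andP[c2y yc1]; have qy : rel_error q y <= (1 - eps) / (2 * L).
    apply: le_trans Delta_le.
    apply: (rel_error_le_Delta qD (subset_trans (@subDsetl _ _ _) R1D) m0).
      by move=> z [_ /negP]; rewrite -ltNge => /enorm_gt/ltW.
    by split=> //; apply/negP; rewrite -ltNge.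
  have := lyapunov_derivative_le Psym lyap L0 (neq0 y c2y) qy.
  rewrite opprB addrAC subrr add0r => /le_trans; apply.
  have := enorm_gt y c2y => /ltW my.
  have : m ^+ 2 <= enorm y ^+ 2 by rewrite ler_pXn2r ?nnegrE ?enorm_ge0 ?(ltW m0).
  by move=> /(ler_wpM2l (ltW eps0)); lra.
have meps0 : 0 < m ^+ 2 * eps by rewrite mulr_gt0// exprn_gt0.
(* As c < c1, continuity keeps the solution inside R1 for a short time after it meets the level c,
   so [rate] applies there. At c = c1 this room is missing. *)
have stays c t0 x : c2 <= c < c1 -> closed_loop_solution A B K D q t0 x ->
    qform P (x t0) <= c -> forall t, t0 <= t -> qform P (x t) <= c.
  move=> /andP[c2c cc1] sol xt0; have [acV aeV] := closed_loop_qform Psym sol.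
  apply: (ac_fun_barrier acV xt0) => s t0s xs.
  have oU : open (qform P @^-1` [set y | y < c1]).
    by apply: open_comp => [y _|]; [exact: continuous_qform|exact: open_lt].
  have [d d0 near_s] := abs_continuous_near sol.1 oU t0s (le_lt_trans xs cc1).
  exists d => //; apply: lebesgue_aeS aeV => t H /andP[st tsd] cxt.
  have [Dx dx] := H (le_lt_trans t0s st); eexists; first exact: dx.
  apply: le_trans (rate _ _) _; last by rewrite oppr_le0 ltW.
  rewrite (le_lt_trans c2c cxt) ltW//; apply: near_s.
  by rewrite (ltW st) tsd.
have reach t0 x : closed_loop_solution A B K D q t0 x ->
    (forall t, t0 <= t -> qform P (x t) <= c1) ->
    exists2 t, t0 <= t <= t0 + T & R2 (x t).
  move=> sol xc1; have [acV aeV] := closed_loop_qform Psym sol.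
  apply: (ac_fun_reach acV meps0 c21 xc1).
  apply: lebesgue_aeS aeV => t H t0t c2x; have [Dx dx] := H t0t.
  by eexists; [exact: dx|apply: rate; rewrite c2x xc1// ltW].
have inv1 : invariant_region A B K D q R1°.
  rewrite interior_ellipsoid// => t0 x sol /= xt0 t t0t.
  (* The initial level lies strictly below c1; it is raised to c2 if necessary to be admissible for
     [stays]. *)
  have : qform P (x t) <= Num.max (qform P (x t0)) c2.
    by apply: (stays _ t0) => //; rewrite ?le_max ?gt_max ?lexx ?orbT ?xt0.
  by move=> /le_lt_trans; apply; rewrite gt_max xt0.
split => //.
- move=> t0 x sol xt0; apply: stays => //; by rewrite lexx.
- move=> t0 x sol xt0; apply: reach => // t t0t.
  exact: (interior_subset (inv1 _ _ sol xt0 t t0t)).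
move=> [U [Uo R1U Uerr]].
(* Just outside R1 the error bound on U takes over: it is the case eps = 0 of the estimate and still
   gives a nonpositive derivative. *)
have invR1 : invariant_region A B K D q R1.
  move=> t0 x sol xt0; have [acV aeV] := closed_loop_qform Psym sol.
  apply: (ac_fun_barrier acV xt0) => s t0s xs.
  have [d d0 near_s] := abs_continuous_near sol.1 Uo t0s (R1U _ xs).
  exists d => //; apply: lebesgue_aeS aeV => t H /andP[st tsd] cxt.
  have [Dx dx] := H (le_lt_trans t0s st); eexists; first exact: dx.
  have Ux : U (x t) by apply: near_s; rewrite (ltW st) tsd.
  have qx : rel_error q (x t) <= 1 / (2 * L).
    by apply: Uerr; split => //; apply/negP; rewrite -ltNge.
  have := lyapunov_derivative_le Psym lyap L0 (neq0 _ (lt_trans c21 cxt)) qx.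
  by rewrite subrr oppr0 mul0r.
by split=> // t0 x sol xt0; apply: reach => //; exact: invR1 sol xt0.
Qed.
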